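(* Let $(m,n)$ and $(m',n')$ be pairs of relatively prime natural numbers. Let $R_1=\mathbb{C}[x,y]/((y-1)(y-x))$, $R_2=\mathbb{C}[x,y,z]/((z-x)(z-y))$, $R_3(m,n)=\mathbb{C}[x,y,z]/((z-x)(z-y),\,y^m-x^n)$, $R_4(m',n')=\mathbb{C}[x,y,z]/((z-x)(z-y),\,x^{n'}y^{m'}-1)$. Then no two of the four rings $R_1$, $R_2$, $R_3(m,n)$, $R_4(m',n')$ are isomorphic as rings.
   Context: Natural numbers are positive integers. Isomorphism means isomorphism of rings, not necessarily $\mathbb{C}$-linear. *)

(* Defs.v *)
From HB Require Import structures.
From mathcomp Require Import all_boot all_order all_algebra.
From mathcomp Require Import ring_quotient.
From mathcomp Require Import boolp reals.
From mathcomp Require Import complex.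
From mathcomp Require Import mpoly.

Set Implicit Arguments.
Unset Strict Implicit.
Unset Printing Implicit Defensive.

Import GRing.Theory.
Local Open Scope ring_scope.

Section GeneratedIdeal.
Variables (A : comNzRingType) (gs : seq A).

Definition in_ideal (p : A) : Prop :=
  exists q : 'I_(size gs) -> A, p = \sum_(i < size gs) q i * gs`_i.

(* The quotients of ring_quotient are nonzero rings, so the library requires a
   proof that the ideal is proper; the predicate itself does not depend on it. *)
Definition gen_ideal_pred of ~ in_ideal 1 : {pred A} := fun p => `[< in_ideal p >].

Variable proper : ~ in_ideal 1.

Lemma gen_ideal_closed : idealr_closed (gen_ideal_pred proper).
Proof.
split.
- by apply/asboolP; exists (fun=> 0); rewrite big1 // => i _; rewrite mul0r.
- by apply/asboolPn.
move=> a u v /asboolP[q ->] /asboolP[r ->]; apply/asboolP.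
exists (fun i => a * q i + r i).
by rewrite mulr_sumr -big_split; apply: eq_bigr => i _; rewrite mulrDl mulrA.
Qed.

HB.instance Definition _ := isIdealr.Build A (gen_ideal_pred proper) gen_ideal_closed.

Definition gen_ideal : idealr A := gen_ideal_pred proper.

End GeneratedIdeal.

Lemma common_zero_proper (K : comNzRingType) n (gs : seq {mpoly K[n]})
    (v : 'I_n -> K) :
  all (fun g => g.@[v] == 0) gs -> ~ in_ideal gs 1.
Proof.
move=> /(all_nthP 0) gs0 [q /(congr1 (meval v))].
rewrite meval1 raddf_sum big1 => [/eqP|i _]; first by rewrite oner_eq0.
by rewrite /= mevalM (eqP (gs0 i _)) ?mulr0.
Qed.

Section Rings.
Variable R : realType.
Local Notation C := R[i].

Section Gens.
Local Notation x := ('X_(@Ordinal 2 0 isT) : {mpoly C[2]}).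
Local Notation y := ('X_(@Ordinal 2 1 isT) : {mpoly C[2]}).

Definition gens1 : seq {mpoly C[2]} := [:: (y - 1) * (y - x)].
End Gens.

Section Gens.
Local Notation x := ('X_(@Ordinal 3 0 isT) : {mpoly C[3]}).
Local Notation y := ('X_(@Ordinal 3 1 isT) : {mpoly C[3]}).
Local Notation z := ('X_(@Ordinal 3 2 isT) : {mpoly C[3]}).

Definition gens2 : seq {mpoly C[3]} := [:: (z - x) * (z - y)].

Definition gens3 (m n : nat) : seq {mpoly C[3]} :=
  [:: (z - x) * (z - y); y ^+ m - x ^+ n].

Definition gens4 (m' n' : nat) : seq {mpoly C[3]} :=
  [:: (z - x) * (z - y); x ^+ n' * y ^+ m' - 1].
End Gens.

Let ev := (mevalM, mevalB, rmorphXn, mevalXU, meval1).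
Let simp := (expr1n, mulr1, subrr, mulr0, eqxx).

Lemma proper1 : ~ in_ideal gens1 1.
Proof. by apply: (@common_zero_proper _ _ _ (fun=> 1)); rewrite /= !ev /= ?ev !simp. Qed.

Lemma proper2 : ~ in_ideal gens2 1.
Proof. by apply: (@common_zero_proper _ _ _ (fun=> 1)); rewrite /= !ev /= ?ev !simp. Qed.

Lemma proper3 m n : ~ in_ideal (gens3 m n) 1.
Proof. by apply: (@common_zero_proper _ _ _ (fun=> 1)); rewrite /= !ev /= ?ev !simp. Qed.

Lemma proper4 m' n' : ~ in_ideal (gens4 m' n') 1.
Proof. by apply: (@common_zero_proper _ _ _ (fun=> 1)); rewrite /= !ev /= ?ev !simp. Qed.

Definition R1 : comNzRingType := {ideal_quot (gen_ideal proper1)}.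
Definition R2 : comNzRingType := {ideal_quot (gen_ideal proper2)}.
Definition R3 (m n : nat) : comNzRingType := {ideal_quot (gen_ideal (@proper3 m n))}.
Definition R4 (m' n' : nat) : comNzRingType := {ideal_quot (gen_ideal (@proper4 m' n'))}.

End Rings.

Definition ring_isomorphic (A B : nzRingType) : Prop :=
  exists f : {rmorphism A -> B}, bijective f.

(* Main.v *)
(* The rings [R1], [R2] and, for [m <> n], [R3 m n] are reduced with exactly two
   minimal primes [(u)] and [(v)], where [u v = 0] is the factored relation. The
   ideal [(u, v)] is therefore intrinsic: it is maximal for [R1], prime but not
   maximal for [R2], and not prime for [R3 m n], whose two copies of the curve
   [y^m = x^n] meet at least over [t = 0] and [t = 1]. For [m = n = 1] the ring
   [R3] is not reduced. Finally, in [R1], [R2] and [R3] every unit is a constant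
   up to a square-zero element, because the units of each of the two components
   are constants and the components meet; hence [s - 1] is invertible or
   square-zero for every unit [s]. In [R4] the unit [x] violates this. *)

Require Import Defs.
From mathcomp Require Import all_boot all_order all_algebra.
From mathcomp Require Import reals.
From mathcomp Require Import ring_quotient boolp complex mpoly ring zify.

Set Implicit Arguments.
Unset Strict Implicit.
Unset Printing Implicit Defensive.

Import GRing.Theory Num.Theory.
Local Open Scope ring_scope.
Local Open Scope quotient_scope.

(** * Ideals generated by finite sequences *)

Lemma in_ideal0 (A : comNzRingType) (gs : seq A) : in_ideal gs 0.
Proof. by exists (fun=> 0); rewrite big1 // => i _; rewrite mul0r. Qed.

Lemma in_idealD (A : comNzRingType) (gs : seq A) (a b : A) :
  in_ideal gs a -> in_ideal gs b -> in_ideal gs (a + b).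
Proof.
move=> [q ->] [r ->]; exists (fun i => q i + r i).
by rewrite -big_split; apply: eq_bigr => i _; rewrite mulrDl.
Qed.

Lemma in_idealMl (A : comNzRingType) (gs : seq A) (a b : A) :
  in_ideal gs b -> in_ideal gs (a * b).
Proof.
move=> [q ->]; exists (fun i => a * q i).
by rewrite mulr_sumr; apply: eq_bigr => i _; rewrite mulrA.
Qed.

Lemma in_idealMr (A : comNzRingType) (gs : seq A) (a b : A) :
  in_ideal gs a -> in_ideal gs (a * b).
Proof. by rewrite mulrC; apply: in_idealMl. Qed.

Lemma in_idealN (A : comNzRingType) (gs : seq A) (a : A) :
  in_ideal gs a -> in_ideal gs (- a).
Proof. by rewrite -mulN1r; apply: in_idealMl. Qed.

Lemma in_ideal_mem (A : comNzRingType) (gs : seq A) (g : A) :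
  g \in gs -> in_ideal gs g.
Proof.
move=> /(nthP 0)[k hk <-].
exists (fun i => (i == Ordinal hk)%:R); rewrite (bigD1 (Ordinal hk)) //= eqxx mul1r.
by rewrite big1 ?addr0 // => i /negbTE ->; rewrite mul0r.
Qed.

Lemma in_ideal1P (A : comNzRingType) (u s : A) :
  in_ideal [:: u] s <-> exists c, s = c * u.
Proof.
split=> [[q ->]|[c ->]]; first by exists (q ord0); rewrite big_ord1.
by apply/in_idealMl/in_ideal_mem; rewrite mem_head.
Qed.

Lemma in_ideal2P (A : comNzRingType) (u v s : A) :
  in_ideal [:: u; v] s <-> exists c d, s = c * u + d * v.
Proof.
split=> [[q ->]|[c [d ->]]].
  by exists (q ord0), (q (lift ord0 ord0)); rewrite big_ord_recl big_ord1.
by apply: in_idealD; apply/in_idealMl/in_ideal_mem; rewrite !inE eqxx ?orbT.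
Qed.

Lemma in_ideal_sub (A : comNzRingType) (gs gs' : seq A) (p : A) :
  (forall g, g \in gs -> in_ideal gs' g) -> in_ideal gs p -> in_ideal gs' p.
Proof.
move=> sub [q ->]; apply: (big_ind (in_ideal gs')) => [|a b|i _].
- exact: in_ideal0.
- exact: in_idealD.
- by apply/in_idealMl/sub/mem_nth.
Qed.

Lemma in_ideal_map (A B : comNzRingType) (f : {rmorphism A -> B}) (gs : seq A)
    (p : A) :
  in_ideal gs p -> in_ideal (map f gs) (f p).
Proof.
move=> [q ->]; rewrite rmorph_sum; apply: (big_ind (in_ideal _)) => [|a b|i _].
- exact: in_ideal0.
- exact: in_idealD.
- by rewrite rmorphM; apply/in_idealMl/in_ideal_mem/map_f/mem_nth.
Qed.

Lemma rmorph_in_ideal (A B : comNzRingType) (f : {rmorphism A -> B})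
    (gs : seq A) (p : A) :
  all (fun g => f g == 0) gs -> in_ideal gs p -> f p = 0.
Proof.
move=> /(all_nthP 0) gs0 [q ->].
by rewrite rmorph_sum big1 // => i _; rewrite rmorphM (eqP (gs0 i _)) ?mulr0.
Qed.

(** * Substitution homomorphisms on polynomial rings *)

Lemma mpoly_ring_ind (K : comNzRingType) (n : nat) (P : {mpoly K[n]} -> Prop) :
    (forall c, P c%:MP) -> (forall i, P 'X_i) ->
    (forall p q, P p -> P q -> P (p + q)) ->
    (forall p q, P p -> P q -> P (p * q)) ->
  forall p, P p.
Proof.
move=> PC PX PD PM p; have P0 : P 0 by rewrite -(mpolyC0 n K); apply: PC.
have P1 : P 1 by rewrite -(mpolyC1 n K); apply: PC.
rewrite [p]mpolyE; apply: (big_ind P P0 PD) => mm _.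
rewrite -mul_mpolyC; apply: (PM) => //; rewrite mpolyXE_id.
apply: (big_ind P P1 PM) => i _; elim: (mm i) => [|k IHk]; first by rewrite expr0.
by rewrite exprS; apply: (PM).
Qed.

(** Congruence modulo an ideal respects sums and products, so it is enough to compare the two
    substitutions on the variables. With the identity as one substitution, this computes kernels of
    substitutions. *)
Lemma in_ideal_mmapB (K S : comNzRingType) (n : nat) (f : {rmorphism K -> S})
    (h k : 'I_n -> S) (gs : seq S) :
  (forall i, in_ideal gs (h i - k i)) ->
  forall p, in_ideal gs (mmap f h p - mmap f k p).
Proof.
move=> hk p; elim/mpoly_ring_ind: p => [c|i|p q IHp IHq|p q IHp IHq].
- by rewrite !mmapC subrr; apply: in_ideal0.
- by rewrite !mmapX !mmap1U.
- by rewrite !mmapD opprD addrACA; apply: in_idealD.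
rewrite !rmorphM /=.
set a := mmap f h p; set b := mmap f k p; set c := mmap f h q; set d := mmap f k q.
have -> : a * c - b * d = a * (c - d) + d * (a - b) by ring.
by apply: in_idealD; apply: in_idealMl.
Qed.

Lemma rmorph_mmap (K S T : comNzRingType) (n : nat) (f : {rmorphism K -> S})
    (g : {rmorphism S -> T}) (h : 'I_n -> S) (p : {mpoly K[n]}) :
  g (mmap f h p) = mmap (g \o f) (g \o h) p.
Proof.
elim/mpoly_ring_ind: p => [c|i|p q IHp IHq|p q IHp IHq].
- by rewrite !mmapC.
- by rewrite !mmapX !mmap1U.
- by rewrite !rmorphD /= IHp IHq.
- by rewrite !rmorphM /= IHp IHq.
Qed.

Lemma mmap_mpolyC_X (K : comNzRingType) (n : nat) (p : {mpoly K[n]}) :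
  mmap (@mpolyC n K) (fun i => 'X_i) p = p.
Proof.
elim/mpoly_ring_ind: p => [c|i|p q IHp IHq|p q IHp IHq].
- by rewrite mmapC.
- by rewrite mmapX mmap1U.
- by rewrite rmorphD /= IHp IHq.
- by rewrite rmorphM /= IHp IHq.
Qed.

(** * Pairs of crossing primes and the ideal they determine *)

(** Zero and units qualify here; in a [crossing] the two non-divisibility fields force the ideals to
    be proper. *)
Definition prime_elt (B : comNzRingType) (u : B) : Prop :=
  forall s t, in_ideal [:: u] (s * t) -> in_ideal [:: u] s \/ in_ideal [:: u] t.

(* Such [u] and [v] generate the two minimal primes, which intersect in 0; so
   the ideal [(u, v)] of the crossing locus is an invariant of the ring. *)
Record crossing (B : comNzRingType) (u v : B) : Prop := Crossing {
  crossing_mul : u * v = 0;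
  crossing_primel : prime_elt u;
  crossing_primer : prime_elt v;
  crossing_ndvdl : ~ in_ideal [:: v] u;
  crossing_ndvdr : ~ in_ideal [:: u] v }.

(** If [v] divides [c * u], then, being prime and not dividing [u], it divides [c]; so [s] is a
    multiple of [v * u = 0]. *)
Lemma crossing_cap (B : comNzRingType) (u v s : B) :
  crossing u v -> in_ideal [:: u] s -> in_ideal [:: v] s -> s = 0.
Proof.
move=> [uv0 _ pv nu _] /in_ideal1P[c ->] /pv[|//] /in_ideal1P[d ->].
by rewrite -mulrA [v * u]mulrC uv0 mulr0.
Qed.

Lemma crossing_reduced (B : comNzRingType) (u v s : B) :
  crossing u v -> s * s = 0 -> s = 0.
Proof.
move=> cuv ss0; have [_ pu pv _ _] := cuv.
apply: (crossing_cap cuv).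
  by case: (pu s s) => //; rewrite ss0; apply: in_ideal0.
by case: (pv s s) => //; rewrite ss0; apply: in_ideal0.
Qed.

(** Since [u' * v' = 0], each of the primes [(u)] and [(v)] contains [u'] or [v']. They cannot
    contain the same one, which would then be zero by [crossing_cap] and divisible by the other. So
    up to order [u] divides [u'] and [v] divides [v']. *)
Lemma crossing_sub (B : comNzRingType) (u v u' v' s : B) :
  crossing u v -> crossing u' v' -> in_ideal [:: u'; v'] s -> in_ideal [:: u; v] s.
Proof.
move=> cuv cuv'; have [uv0 pu pv _ _] := cuv; have [uv0' _ _ nu' nv'] := cuv'.
have dvdl a : in_ideal [:: u] a -> in_ideal [:: u; v] a.
  apply: in_ideal_sub => g; rewrite inE => /eqP ->.
  by apply: in_ideal_mem; rewrite mem_head.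
have dvdr a : in_ideal [:: v] a -> in_ideal [:: u; v] a.
  apply: in_ideal_sub => g; rewrite inE => /eqP ->.
  by apply: in_ideal_mem; rewrite !inE eqxx orbT.
have zero_dvd a b : a = 0 -> in_ideal [:: b] a by move=> ->; apply: in_ideal0.
apply: in_ideal_sub => g.
have [ku|kv] : in_ideal [:: u] u' \/ in_ideal [:: u] v' by apply/pu/zero_dvd.
  have [kv'|kv'] : in_ideal [:: v] u' \/ in_ideal [:: v] v' by apply/pv/zero_dvd.
    by case: nu'; apply: zero_dvd; apply: crossing_cap cuv ku kv'.
  by rewrite !inE => /orP[]/eqP->; [apply: dvdl|apply: dvdr].
have [ku'|kv'] : in_ideal [:: v] u' \/ in_ideal [:: v] v' by apply/pv/zero_dvd.
  by rewrite !inE => /orP[]/eqP->; [apply: dvdr|apply: dvdl].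
by case: nv'; apply: zero_dvd; apply: crossing_cap cuv kv kv'.
Qed.

Lemma crossing_ideal_eq (B : comNzRingType) (u v u' v' s : B) :
  crossing u v -> crossing u' v' ->
  in_ideal [:: u; v] s <-> in_ideal [:: u'; v'] s.
Proof. by move=> cuv cuv'; split; apply: crossing_sub. Qed.

(* The square-zero alternative is what keeps [R3 1 1], which has the units
   [1 + (z - x) * p], on the right side of this property. *)
Definition unit_gap (B : comNzRingType) : Prop :=
  forall s t : B, s * t = 1 ->
    (exists t', (s - 1) * t' = 1) \/ (s - 1) * (s - 1) = 0.

(** * Presented rings, their components and kernels of substitutions *)

Section Presentation.
Variables (K : fieldType) (n : nat) (gs : seq {mpoly K[n]}) (B : comNzRingType).
Variable pi : {rmorphism {mpoly K[n]} -> B}.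

(** The target [B] is arbitrary, so an isomorphism merely transports the presentation, and the
    invariants of two isomorphic rings can be compared inside one ring. *)
Definition presents : Prop :=
  (forall b, exists p, b = pi p) /\ (forall p, pi p = 0 <-> in_ideal gs p).

Hypothesis piP : presents.

(** Such an [f] factors through [B] modulo the images of [us]: after lifting the coefficients to
    polynomials, the error lies in the kernel of [pi], which is generated by [gs]. *)
Lemma presents_kernel (D : comNzRingType) (f : {rmorphism {mpoly K[n]} -> D})
    (us : seq {mpoly K[n]}) (p : {mpoly K[n]}) :
    all (fun g => f g == 0) gs -> all (fun g => f g == 0) us ->
  in_ideal (map pi us) (pi p) -> f p = 0.
Proof.
move=> f_gs f_us [q].
(* The index types of [q] and [r] differ by [size_map]; quantifying over both bound proofs keeps
   casts out of the sums. *)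
have [r hr] : exists r : 'I_(size us) -> {mpoly K[n]},
    forall i (hi : (i < size (map pi us))%N),
    forall hi' : (i < size us)%N, q (Ordinal hi) = pi (r (Ordinal hi')).
  have hs : size (map pi us) = size us by rewrite size_map.
  have [r hr] := choice (fun i : 'I_(size us) => piP.1 (q (cast_ord (esym hs) i))).
  exists r => i hi hi'; rewrite -hr; congr q; exact: val_inj.
move=> e; have {e} : pi (p - \sum_(i < size us) r i * us`_i) = 0.
  rewrite rmorphB e /= rmorph_sum /=; apply/eqP; rewrite subr_eq0; apply/eqP.
  move: q hr {e}; rewrite size_map => q hr; apply: eq_bigr => i _.
  by rewrite rmorphM /= (nth_map 0) //; congr (_ * _); case: i => i hi; apply: hr.
move=> /piP.2 /(rmorph_in_ideal f_gs) /eqP.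
rewrite rmorphB subr_eq0 => /eqP ->.
by apply: (rmorph_in_ideal f_us); exists r.
Qed.

(* [f] identifies [B / (pi u)] with a subring of the domain [D]. *)
Definition component (D : idomainType) (f : {rmorphism {mpoly K[n]} -> D})
    (u : {mpoly K[n]}) : Prop :=
  [/\ all (fun g => f g == 0) gs, f u = 0 &
      forall p, f p = 0 -> in_ideal [:: pi u] (pi p)].

Lemma component_kernel (D : idomainType) (f : {rmorphism {mpoly K[n]} -> D})
    (u p : {mpoly K[n]}) :
  component f u -> in_ideal [:: pi u] (pi p) <-> f p = 0.
Proof.
move=> [f_gs f_u f_ker]; split=> [|/f_ker //].
by apply: (presents_kernel (us := [:: u])) => //=; rewrite f_u eqxx.
Qed.

Lemma component_prime (D : idomainType) (f : {rmorphism {mpoly K[n]} -> D})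
    (u : {mpoly K[n]}) :
  component f u -> prime_elt (pi u).
Proof.
move=> cu s t; have [p ->] := piP.1 s; have [q ->] := piP.1 t.
rewrite -rmorphM => /(component_kernel _ cu); rewrite rmorphM => /eqP.
by rewrite mulf_eq0 => /orP[]/eqP/(component_kernel _ cu); [left|right].
Qed.

(** A unit of [B] maps to a unit of the component, hence to a constant, and the kernel of [B] onto
    the component is [(pi u)]. *)
Lemma component_unit (D : idomainType) (f : {rmorphism {mpoly K[n]} -> D})
    (u : {mpoly K[n]}) :
    component f u -> (forall a b : D, a * b = 1 -> exists c, a = f c%:MP) ->
  forall s t, s * t = 1 -> exists c, in_ideal [:: pi u] (s - pi c%:MP).
Proof.
move=> cu D_unit s t; have [p ->] := piP.1 s; have [q ->] := piP.1 t => pq1.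
have /D_unit[c fp] : f p * f q = 1.
  apply/eqP; rewrite -subr_eq0 -rmorphM -(rmorph1 f) -rmorphB; apply/eqP.
  apply/(component_kernel _ cu).
  by rewrite rmorphB rmorphM pq1 rmorph1 subrr; apply: in_ideal0.
by exists c; rewrite -rmorphB; apply/(component_kernel _ cu); rewrite rmorphB fp subrr.
Qed.

Lemma component_crossing (D E : idomainType)
    (f : {rmorphism {mpoly K[n]} -> D}) (g : {rmorphism {mpoly K[n]} -> E})
    (u v : {mpoly K[n]}) :
    component f u -> component g v -> u * v \in gs -> g u != 0 -> f v != 0 ->
  crossing (pi u) (pi v).
Proof.
move=> cu cv uv /eqP gu /eqP fv; split.
- by rewrite -rmorphM; apply/piP.2/in_ideal_mem.
- exact: component_prime cu.
- exact: component_prime cv.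
- by move=> /(component_kernel _ cv).
- by move=> /(component_kernel _ cu).
Qed.

(** A unit is congruent to a constant on each component, and evaluation at the common point [a]
    shows that the two constants agree. The difference of the unit and this constant is a multiple
    of both [pi u] and [pi v], so its square is zero. *)
Lemma unit_gap_of_components (u v : {mpoly K[n]}) (a : 'I_n -> K) :
    all (fun g => g.@[a] == 0) gs -> u.@[a] == 0 -> v.@[a] == 0 -> u * v \in gs ->
    (forall s t, s * t = 1 -> exists c, in_ideal [:: pi u] (s - pi c%:MP)) ->
    (forall s t, s * t = 1 -> exists c, in_ideal [:: pi v] (s - pi c%:MP)) ->
  unit_gap B.
Proof.
move=> gsa ua va uv Uu Uv s t st1.
have uv0 : pi u * pi v = 0 by rewrite -rmorphM; apply/piP.2/in_ideal_mem.
have [p sp] := piP.1 s.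
have value w c : w.@[a] == 0 -> in_ideal [:: pi w] (s - pi c%:MP) -> c = p.@[a].
  move=> wa; rewrite sp -rmorphB => h.
  have : (p - c%:MP).@[a] = 0.
    by apply: (presents_kernel (us := [:: w])) h => //=; rewrite wa.
  by rewrite rmorphB /= mevalC => /eqP; rewrite subr_eq0 => /eqP.
have [c hc] := Uu _ _ st1; have [d hd] := Uv _ _ st1.
have cd : d = c by rewrite (value _ _ ua hc) (value _ _ va hd).
rewrite {}cd in hd; set w := s - pi c%:MP in hc hd.
have ww : w * w = 0.
  move/in_ideal1P: hc hd => [k ek] /in_ideal1P[l el].
  by rewrite {1}ek el mulrACA uv0 mulr0.
have sw : s = pi c%:MP + w by rewrite /w addrC subrK.
have [c1|c1] := eqVneq c 1.
  by right; rewrite sw c1 mpolyC1 rmorph1 addrC addKr.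
(* As [w ^+ 2 = 0], the product of [c - 1 + w] and [c - 1 - w] is [(c - 1) ^+ 2]. *)
left; exists ((pi (c - 1)%:MP - w) * (pi (c - 1)^-1%:MP) ^+ 2).
have -> : s - 1 = pi (c - 1)%:MP + w.
  by rewrite mpolyCB rmorphB mpolyC1 rmorph1 sw addrAC.
rewrite mulrA [X in X * _]mulrC -subr_sqr [w ^+ 2]expr2 ww subr0 -exprMn -rmorphM -mpolyCM.
by rewrite mulfV ?subr_eq0 // mpolyC1 rmorph1 expr1n.
Qed.

Lemma subst_kernel (h : 'I_n -> {mpoly K[n]}) (u p : {mpoly K[n]}) :
    (forall i, in_ideal [:: u] ('X_i - h i)) -> mmap (@mpolyC n K) h p = 0 ->
  in_ideal [:: pi u] (pi p).
Proof.
move=> hu hp; rewrite -[p]subr0 -hp -{1}[p]mmap_mpolyC_X.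
by apply: (in_ideal_map pi (gs := [:: u])); apply: in_ideal_mmapB.
Qed.

(** Modulo [u], the image of [p] is [p] evaluated at [w]. The first hypothesis says that this
    evaluation factors through the parametrization [h], as a left inverse of [h] would provide. *)
Lemma kernel_of_section (S : comNzRingType) (f : {rmorphism K -> S})
    (h : 'I_n -> S) (w : 'I_n -> B) (u : B) :
    (forall p, mmap f h p = 0 -> mmap (pi \o @mpolyC n K) w p = 0) ->
    (forall i, in_ideal [:: u] (pi 'X_i - w i)) ->
  forall p, mmap f h p = 0 -> in_ideal [:: u] (pi p).
Proof.
move=> hw hu p /hw wp; rewrite -[p]mmap_mpolyC_X rmorph_mmap -[X in in_ideal _ X]subr0 -wp.
exact: in_ideal_mmapB.
Qed.

End Presentation.

(* Sending [t^k] to [x^i y^j] for any [(i, j)] with [m i + n j = k] is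
   well defined by coprimality, and inverts [x, y |-> t^m, t^n] on the left. *)
Lemma cusp_kernel (K S : comNzRingType) (f : {rmorphism K -> S}) (x y : S)
    (m n k : nat) (a b : 'I_k -> nat) (p : {mpoly K[k]}) :
    (0 < n)%N -> coprime m n -> y ^+ m = x ^+ n ->
  mmap (@polyC K) (fun i => 'X^(m * a i + n * b i)) p = 0 ->
  mmap f (fun i => x ^+ a i * y ^+ b i) p = 0.
Proof.
move=> n0 mn yx.
(* For equal weights with [i' <= i], coprimality gives [i = i' + n q] and [j' = j + m q]; the
   relation then trades [x^(n q)] for [y^(m q)]. *)
have wd i j i' j' : (m * i + n * j = m * i' + n * j')%N ->
    x ^+ i * y ^+ j = x ^+ i' * y ^+ j'.
  wlog le : i j i' j' / (i' <= i)%N.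
    by move=> W e; have [/W|/ltnW/W] := leqP i' i; [|symmetry]; auto.
  move=> e.
  have le' : (j <= j')%N.
    by rewrite -(leq_pmul2l n0) -(leq_add2l (m * i')) -e leq_add2r leq_mul2l le orbT.
  have /dvdnP[q eq_i] : (n %| i - i')%N.
    rewrite -(Gauss_dvdr _ (_ : coprime n m)) 1?coprime_sym // mulnBr.
    have -> : (m * i - m * i' = n * j' - n * j)%N by lia.
    by rewrite -mulnBr dvdn_mulr.
  have ei : i = (i' + n * q)%N by rewrite mulnC -eq_i subnKC.
  have ej : j' = (j + m * q)%N.
    apply/eqP; rewrite -(eqn_pmul2l n0) -(eqn_add2l (m * i')) -e ei; apply/eqP.
    ring.
  by rewrite ei ej !exprD !exprM yx; ring.
(* [g d] is the common value of the monomials of weight [d], and 0 at the gaps of the semigroup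
   generated by [m] and [n]. *)
have [g hg] : exists g : nat -> S, forall i j, g (m * i + n * j)%N = x ^+ i * y ^+ j.
  suff /choice[g hg] : forall d, exists e : S,
      forall i j, (m * i + n * j)%N = d -> x ^+ i * y ^+ j = e.
    by exists g => i j; rewrite (hg _ i j erefl).
  move=> d; have [[[i j] /= eij]|no] := pselect (exists ij, (m * ij.1 + n * ij.2)%N = d).
    by exists (x ^+ i * y ^+ j) => i' j' e'; apply: wd; rewrite eij.
  by exists 0 => i j e; case: no; exists (i, j).
pose w (q : 'X_{1..k}) := (m * (\sum_i a i * q i) + n * (\sum_i b i * q i))%N.
have hw q : mmap1 (fun i => x ^+ a i * y ^+ b i) q = g (w q).
  rewrite hg /mmap1 !expr_sum -big_split; apply: eq_bigr => i _.
  by rewrite exprMn -!exprM.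
have hX q : mmap1 (fun i => 'X^(m * a i + n * b i) : {poly K}) q = 'X^(w q).
  rewrite /mmap1 /w !big_distrr -big_split expr_sum; apply: eq_bigr => i _ /=.
  by rewrite -exprM mulnDl !mulnA.
rewrite /mmap => p0.
pose N := (\max_(q <- msupp p) w q).+1.
(* Grouping the monomials by weight expresses the value through the coefficients of the parametrized
   polynomial, which is zero; [N] exceeds every weight that occurs. *)
transitivity (\sum_(d < N) f (\sum_(q <- msupp p) (p@_q *: 'X^(w q) : {poly K}))`_d * g d).
  transitivity (\sum_(q <- msupp p) \sum_(d < N) f (p@_q *: 'X^(w q) : {poly K})`_d * g d).
    apply: eq_big_seq => q hq.
    have wN : (w q < N)%N by rewrite ltnS leq_bigmax_seq.
    rewrite (bigD1 (Ordinal wN)) //= big1 => [|d].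
      by rewrite coefZ coefXn eqxx mulr1 addr0 hw.
    by rewrite -val_eqE /= coefZ coefXn => /negbTE ->; rewrite mulr0 rmorph0 mul0r.
  rewrite exchange_big; apply: eq_bigr => d _.
  by rewrite coef_sum rmorph_sum mulr_suml.
have {}p0 : \sum_(q <- msupp p) (p@_q *: 'X^(w q) : {poly K}) = 0.
  by rewrite -[RHS]p0; apply: eq_bigr => q _; rewrite hX mul_polyC.
by rewrite p0 big1 // => d _; rewrite coef0 rmorph0 mul0r.
Qed.

(** * Quotient rings as presentations, transport, and units of polynomial rings *)

Lemma ideal_quot_presents (K : fieldType) (n : nat) (gs : seq {mpoly K[n]})
    (proper : ~ in_ideal gs 1) :
  presents gs (\pi_({ideal_quot (gen_ideal proper)}) : {rmorphism _ -> _}).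
Proof.
split=> [b|p]; first by exists (repr b); rewrite /= reprK.
rewrite -(rmorph0 (\pi_({ideal_quot (gen_ideal proper)}))); split.
  by move=> /eqP; rewrite -Quotient.idealrBE subr0 => /asboolP.
by move=> h; apply/eqP; rewrite -Quotient.idealrBE subr0; apply/asboolP.
Qed.

Lemma presents_iso (K : fieldType) (n : nat) (gs : seq {mpoly K[n]})
    (A B : comNzRingType) (pi : {rmorphism {mpoly K[n]} -> A}) :
    presents gs pi -> ring_isomorphic A B ->
  exists pi' : {rmorphism {mpoly K[n]} -> B}, presents gs pi'.
Proof.
move=> [pi_surj pi_ker] [f [g fK gK]]; exists (f \o pi : {rmorphism _ -> _}).
split=> [b|p] /=; first by have [p e] := pi_surj (g b); exists p; rewrite -e gK.
rewrite -pi_ker; split=> [|->]; last by rewrite rmorph0.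
by move=> e; apply: (can_inj fK); rewrite e rmorph0.
Qed.

Lemma mpoly_unit_const (K : fieldType) (n : nat) (p q : {mpoly K[n]}) :
  p * q = 1 -> exists c, p = c%:MP.
Proof.
rewrite mulrC => /(@mpoly_intro_unit _ _ p q) /andP[/eqP -> _].
by exists p@_0%MM.
Qed.

Lemma poly_unit_const (K : fieldType) (p q : {poly K}) :
  p * q = 1 -> exists c, p = c%:P.
Proof.
move=> pq1; have : p \is a GRing.unit by apply/unitrPr; exists q.
by rewrite poly_unitE => /andP[/size_poly1P[c _ ->] _]; exists c.
Qed.

Lemma forall_ord2 (P : 'I_2 -> Prop) :
  P (@Ordinal 2 0 isT) -> P (@Ordinal 2 1 isT) -> forall i, P i.
Proof.
move=> P0 P1 [[|[|//]] hi]; [move: P0|move: P1]; congr P; exact: val_inj.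
Qed.

Lemma forall_ord3 (P : 'I_3 -> Prop) :
    P (@Ordinal 3 0 isT) -> P (@Ordinal 3 1 isT) -> P (@Ordinal 3 2 isT) ->
  forall i, P i.
Proof.
move=> P0 P1 P2 [[|[|[|//]]] hi]; [move: P0|move: P1|move: P2]; congr P; exact: val_inj.
Qed.

Lemma mpoly_neq0 (K : comNzRingType) (n : nat) (p : {mpoly K[n]}) (a : 'I_n -> K) :
  p.@[a] != 0 -> p != 0.
Proof. by apply: contraNneq => ->; rewrite meval0. Qed.

(** * The ring [R1]: two crossing lines *)

Section LinePair.
Variables (R : realType) (B : comNzRingType).
Variable pi : {rmorphism {mpoly R[i][2]} -> B}.
Hypothesis piP : presents (gens1 R) pi.

Local Notation x := ('X_(@Ordinal 2 0 isT) : {mpoly R[i][2]}).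
Local Notation y := ('X_(@Ordinal 2 1 isT) : {mpoly R[i][2]}).
Local Notation subst a b :=
  (mmap (@mpolyC 2 R[i]) (fun i : 'I_2 => nth 0 [:: a; b] i) : {rmorphism _ -> _}).

(** The line is realized inside the two-variable polynomial ring itself, by the retraction
    [x, y |-> x, 1] with kernel [(y - 1)]. *)
Lemma gens1_componentl : component (gens1 R) pi (subst x 1) (y - 1).
Proof.
set f : {rmorphism _ -> _} := subst x 1.
have [fx fy] : f x = x /\ f y = 1 by split; rewrite /f /= mmapX mmap1U.
split=> [||p].
- by rewrite /= rmorphM !rmorphB rmorph1 /= fy subrr mul0r eqxx.
- by rewrite rmorphB rmorph1 /= fy subrr.
apply: subst_kernel; apply: forall_ord2; rewrite /= ?subrr.
  exact: in_ideal0.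
by apply: in_ideal_mem; rewrite mem_head.
Qed.

Lemma gens1_componentr : component (gens1 R) pi (subst x x) (y - x).
Proof.
set f : {rmorphism _ -> _} := subst x x.
have [fx fy] : f x = x /\ f y = x by split; rewrite /f /= mmapX mmap1U.
split=> [||p].
- by rewrite /= rmorphM !rmorphB rmorph1 /= fx fy subrr mulr0 eqxx.
- by rewrite rmorphB /= fx fy subrr.
apply: subst_kernel; apply: forall_ord2; rewrite /= ?subrr.
  exact: in_ideal0.
by apply: in_ideal_mem; rewrite mem_head.
Qed.

Lemma gens1_crossing : crossing (pi (y - 1)) (pi (y - x)).
Proof.
apply: (component_crossing piP gens1_componentl gens1_componentr).
- by rewrite mem_head.
- apply: (@mpoly_neq0 _ _ _ (fun=> 0)).
  rewrite rmorphB rmorph1 /= !mmapX !mmap1U /= mevalB mevalXU meval1.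
  by rewrite sub0r oppr_eq0 oner_eq0.
- apply: (@mpoly_neq0 _ _ _ (fun=> 0)).
  by rewrite rmorphB /= !mmapX !mmap1U /= mevalB mevalXU meval1 subr0 oner_eq0.
Qed.

Lemma gens1_unit_gap : unit_gap B.
Proof.
(* The two lines meet at [(1, 1)]. *)
apply: (unit_gap_of_components piP (a := fun=> 1) (u := y - 1) (v := y - x)).
- by rewrite /= mevalM !mevalB !mevalXU meval1 subrr mul0r eqxx.
- by rewrite mevalB mevalXU meval1 subrr.
- by rewrite mevalB !mevalXU subrr.
- by rewrite mem_head.
- apply: (component_unit piP gens1_componentl) => a b /mpoly_unit_const[c ->].
  by exists c; rewrite /= mmapC.
- apply: (component_unit piP gens1_componentr) => a b /mpoly_unit_const[c ->].
  by exists c; rewrite /= mmapC.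
Qed.

(** Modulo the ideal both variables become 1, so [pi p] is congruent to the constant [p(1, 1)],
    which is zero or invertible. *)
Lemma gens1_maximal (s : B) :
  in_ideal [:: pi (y - 1); pi (y - x)] s \/
  exists t, in_ideal [:: pi (y - 1); pi (y - x)] (s * t - 1).
Proof.
have [p ->] := piP.1 s; pose c := p.@[fun=> 1].
have pc : in_ideal [:: pi (y - 1); pi (y - x)] (pi p - pi c%:MP).
  rewrite -rmorphB; apply: (in_ideal_map pi (gs := [:: y - 1; y - x])).
  have -> : c%:MP = mmap (@mpolyC 2 R[i]) (fun=> 1) p.
    by rewrite /c /meval rmorph_mmap; apply: eq_bigr => m _; rewrite /mmap1 /= rmorph1.
  rewrite -{1}[p]mmap_mpolyC_X; apply: in_ideal_mmapB; apply: forall_ord2.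
    (* Here [x - 1 = (y - 1) - (y - x)]. *)
    apply/in_ideal2P; exists 1, (-1); ring.
  by apply: in_ideal_mem; rewrite mem_head.
have [c0|c0] := eqVneq c 0; [left|right].
  by rewrite c0 mpolyC0 rmorph0 subr0 in pc.
exists (pi c^-1%:MP).
have -> : pi p * pi c^-1%:MP - 1 = (pi p - pi c%:MP) * pi c^-1%:MP.
  by rewrite mulrBl -[X in _ = _ - X]rmorphM -mpolyCM mulfV // mpolyC1 rmorph1.
exact: in_idealMr.
Qed.

End LinePair.

Section Space.
Variables (R : realType).

Local Notation x := ('X_(@Ordinal 3 0 isT) : {mpoly R[i][3]}).
Local Notation y := ('X_(@Ordinal 3 1 isT) : {mpoly R[i][3]}).
Local Notation z := ('X_(@Ordinal 3 2 isT) : {mpoly R[i][3]}).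

Lemma gens2_vanish (c : R[i]) : all (fun g => g.@[fun=> c] == 0) (gens2 R).
Proof. by rewrite /= mevalM !mevalB !mevalXU subrr mul0r eqxx. Qed.

(** * The ring [R2]: two planes crossing in a line *)

Section PlanePair.
Variables (B : comNzRingType) (pi : {rmorphism {mpoly R[i][3]} -> B}).
Hypothesis piP : presents (gens2 R) pi.

Local Notation subst a b c :=
  (mmap (@mpolyC 3 R[i]) (fun i : 'I_3 => nth 0 [:: a; b; c] i) : {rmorphism _ -> _}).

Lemma gens2_componentl : component (gens2 R) pi (subst x y x) (z - x).
Proof.
set f : {rmorphism _ -> _} := subst x y x.
have [fx fy fz] : [/\ f x = x, f y = y & f z = x].
  by split; rewrite /f /= mmapX mmap1U.
split=> [||p].
- by rewrite /= rmorphM !rmorphB /= fx fz subrr mul0r eqxx.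
- by rewrite rmorphB /= fx fz subrr.
apply: subst_kernel; apply: forall_ord3; rewrite /= ?subrr; try exact: in_ideal0.
by apply: in_ideal_mem; rewrite mem_head.
Qed.

Lemma gens2_componentr : component (gens2 R) pi (subst x y y) (z - y).
Proof.
set f : {rmorphism _ -> _} := subst x y y.
have [fx fy fz] : [/\ f x = x, f y = y & f z = y].
  by split; rewrite /f /= mmapX mmap1U.
split=> [||p].
- by rewrite /= rmorphM !rmorphB /= fy fz subrr mulr0 eqxx.
- by rewrite rmorphB /= fy fz subrr.
apply: subst_kernel; apply: forall_ord3; rewrite /= ?subrr; try exact: in_ideal0.
by apply: in_ideal_mem; rewrite mem_head.
Qed.

Lemma gens2_crossing : crossing (pi (z - x)) (pi (z - y)).
Proof.
apply: (component_crossing piP gens2_componentl gens2_componentr).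
- by rewrite mem_head.
- apply: (@mpoly_neq0 _ _ _ (fun i => (i == 1%N :> nat)%:R)).
  by rewrite rmorphB /= !mmapX !mmap1U /= mevalB !mevalXU /= subr0 oner_eq0.
- apply: (@mpoly_neq0 _ _ _ (fun i => (i == 0%N :> nat)%:R)).
  by rewrite rmorphB /= !mmapX !mmap1U /= mevalB !mevalXU /= subr0 oner_eq0.
Qed.

Lemma gens2_unit_gap : unit_gap B.
Proof.
apply: (unit_gap_of_components piP (a := fun=> 1) (u := z - x) (v := z - y)).
- exact: gens2_vanish.
- by rewrite mevalB !mevalXU subrr.
- by rewrite mevalB !mevalXU subrr.
- by rewrite mem_head.
- apply: (component_unit piP gens2_componentl) => a b /mpoly_unit_const[c ->].
  by exists c; rewrite /= mmapC.
- apply: (component_unit piP gens2_componentr) => a b /mpoly_unit_const[c ->].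
  by exists c; rewrite /= mmapC.
Qed.

(** The planes meet in the line [x = y = z], whose coordinate ring is a polynomial ring in [z],
    hence a domain. *)
Lemma gens2_prime (s t : B) :
    in_ideal [:: pi (z - x); pi (z - y)] (s * t) ->
  in_ideal [:: pi (z - x); pi (z - y)] s \/ in_ideal [:: pi (z - x); pi (z - y)] t.
Proof.
pose f : {rmorphism _ -> _} := subst z z z.
have [fx fy fz] : [/\ f x = z, f y = z & f z = z] by split; rewrite /f /= mmapX mmap1U.
have kerP p : in_ideal [:: pi (z - x); pi (z - y)] (pi p) <-> f p = 0.
  split=> [|fp].
    apply: (presents_kernel piP (us := [:: z - x; z - y])); rewrite /=.
      by rewrite rmorphM !rmorphB fx fz subrr mul0r eqxx.
    by rewrite !rmorphB fx fy fz subrr eqxx.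
  apply: (in_ideal_map pi (gs := [:: z - x; z - y])).
  rewrite -[p]subr0 -fp -{1}[p]mmap_mpolyC_X; apply: in_ideal_mmapB.
  apply: forall_ord3; rewrite /= ?subrr; last exact: in_ideal0.
    by rewrite -[X in in_ideal _ X]opprB; apply/in_idealN/in_ideal_mem; rewrite mem_head.
  rewrite -[X in in_ideal _ X]opprB; apply/in_idealN/in_ideal_mem.
  by rewrite !inE eqxx orbT.
have [p ->] := piP.1 s; have [q ->] := piP.1 t.
rewrite -rmorphM => /kerP; rewrite rmorphM => /eqP.
by rewrite mulf_eq0 => /orP[]/eqP/kerP; [left|right].
Qed.

End PlanePair.

(** The ideal vanishes at [(0, 0, 0)] and [(1, 1, 1)]. Since [x] is 0 at the first point and 1 at
    the second, it is neither invertible modulo the ideal nor in it. *)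
Lemma not_maximal_of_points (B : comNzRingType)
    (pi : {rmorphism {mpoly R[i][3]} -> B}) (gs : seq {mpoly R[i][3]}) :
    presents gs pi ->
    all (fun g => g.@[fun=> 0] == 0) gs -> all (fun g => g.@[fun=> 1] == 0) gs ->
  ~ (forall s, in_ideal [:: pi (z - x); pi (z - y)] s \/
               exists t, in_ideal [:: pi (z - x); pi (z - y)] (s * t - 1)).
Proof.
move=> piP gs0 gs1.
have vanish (c : R[i]) p : all (fun g => g.@[fun=> c] == 0) gs ->
    in_ideal [:: pi (z - x); pi (z - y)] (pi p) -> p.@[fun=> c] = 0.
  move=> gsc; apply: (presents_kernel piP (us := [:: z - x; z - y])) => //=.
  by rewrite !mevalB !mevalXU subrr eqxx.
move=> /(_ (pi x))[/(vanish _ _ gs1)/eqP|[t]].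
  by rewrite mevalXU oner_eq0.
have [q ->] := piP.1 t; rewrite -rmorphM -(rmorph1 pi) -rmorphB.
move=> /(vanish _ _ gs0)/eqP.
by rewrite mevalB mevalM mevalXU mul0r meval1 sub0r oppr_eq0 oner_eq0.
Qed.

(** * The ring [R3]: two copies of the curve [y^m = x^n] *)

Section CuspPair.
Variables (m n : nat).
Hypotheses (hm : (0 < m)%N) (hn : (0 < n)%N) (hmn : coprime m n).
Variables (B : comNzRingType) (pi : {rmorphism {mpoly R[i][3]} -> B}).
Hypothesis piP : presents (gens3 R m n) pi.

Lemma gens3_vanish (c : R[i]) :
  c ^+ m = c ^+ n -> all (fun g => g.@[fun=> c] == 0) (gens3 R m n).
Proof.
by move=> ce; rewrite /= mevalM !mevalB !rmorphXn /= !mevalXU ce !subrr mul0r eqxx.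
Qed.

Lemma gens3_pi : pi y ^+ m = pi x ^+ n.
Proof.
apply/eqP; rewrite -subr_eq0 -!rmorphXn -rmorphB; apply/eqP/piP.2/in_ideal_mem.
by rewrite !inE eqxx orbT.
Qed.

(** The lists hold the exponents of the monomials [x], [y] and [x^a y^b] put for the three
    variables, in the shape of [cusp_kernel]. The pairs [(1, 0)] and [(0, 1)] for [(a, b)] give the
    components [z = x] and [z = y]. *)
Definition cusp_param (a b : nat) : {rmorphism {mpoly R[i][3]} -> {poly R[i]}} :=
  mmap (@polyC R[i])
    (fun i => 'X^(m * nth 0%N [:: 1; 0; a]%N i + n * nth 0%N [:: 0; 1; b]%N i)).

Lemma cusp_paramE (a b : nat) :
  [/\ cusp_param a b x = 'X^m, cusp_param a b y = 'X^n &
      cusp_param a b z = 'X^(m * a + n * b)].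
Proof. by split; rewrite /cusp_param /= mmapX mmap1U /= ?muln1 ?muln0 ?addn0. Qed.

Lemma cusp_param_kernel (a b : nat) (p : {mpoly R[i][3]}) :
  cusp_param a b p = 0 -> in_ideal [:: pi z - pi x ^+ a * pi y ^+ b] (pi p).
Proof.
apply: (kernel_of_section (w := fun i => pi x ^+ nth 0%N [:: 1; 0; a]%N i *
                                       pi y ^+ nth 0%N [:: 0; 1; b]%N i)).
  by move=> q; apply: cusp_kernel => //; apply: gens3_pi.
apply: forall_ord3; rewrite /= ?expr1 ?expr0 ?mulr1 ?mul1r ?subrr; try exact: in_ideal0.
by apply: in_ideal_mem; rewrite mem_head.
Qed.

Lemma gens3_componentl : component (gens3 R m n) pi (cusp_param 1 0) (z - x).
Proof.
have [fx fy fz] := cusp_paramE 1 0; rewrite muln1 muln0 addn0 in fz.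
split=> [||p].
- by rewrite /= rmorphM !rmorphB !rmorphXn fx fy fz subrr mul0r -!exprM mulnC subrr eqxx.
- by rewrite rmorphB fx fz subrr.
by move=> /cusp_param_kernel; rewrite expr0 mulr1 expr1 rmorphB.
Qed.

Lemma gens3_componentr : component (gens3 R m n) pi (cusp_param 0 1) (z - y).
Proof.
have [fx fy fz] := cusp_paramE 0 1; rewrite muln1 muln0 add0n in fz.
split=> [||p].
- by rewrite /= rmorphM !rmorphB !rmorphXn fx fy fz subrr mulr0 -!exprM mulnC subrr eqxx.
- by rewrite rmorphB fy fz subrr.
by move=> /cusp_param_kernel; rewrite expr0 mul1r expr1 rmorphB.
Qed.

Lemma gens3_unit_gap : unit_gap B.
Proof.
have unitC a b (p q : {poly R[i]}) : p * q = 1 -> exists c, p = cusp_param a b c%:MP.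
  by move=> /poly_unit_const[c ->]; exists c; rewrite /cusp_param /= mmapC.
apply: (unit_gap_of_components piP (a := fun=> 1) (u := z - x) (v := z - y)).
- by apply: gens3_vanish; rewrite !expr1n.
- by rewrite mevalB !mevalXU subrr.
- by rewrite mevalB !mevalXU subrr.
- by rewrite mem_head.
- exact: component_unit gens3_componentl (unitC _ _).
- exact: component_unit gens3_componentr (unitC _ _).
Qed.

(** On the other component each generator becomes [t^m - t^n] up to sign, which is nonzero for
    distinct exponents. *)
Lemma gens3_crossing : m != n -> crossing (pi (z - x)) (pi (z - y)).
Proof.
move=> ne; apply: (component_crossing piP gens3_componentl gens3_componentr).
- by rewrite mem_head.
- have [fx fy fz] := cusp_paramE 0 1; rewrite rmorphB fx fz muln1 muln0 add0n.
  apply/eqP => /(congr1 (fun p : {poly R[i]} => p`_n)); rewrite coefB !coefXn eqxx coef0.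
  by rewrite eq_sym (negbTE ne) subr0 => /eqP; rewrite oner_eq0.
- have [fx fy fz] := cusp_paramE 1 0; rewrite rmorphB fy fz muln1 muln0 addn0.
  apply/eqP => /(congr1 (fun p : {poly R[i]} => p`_m)); rewrite coefB !coefXn eqxx coef0.
  by rewrite (negbTE ne) subr0 => /eqP; rewrite oner_eq0.
Qed.

(* The two copies of the curve meet at the points [(t, t, t)] with
   [t^m = t^n], among them [t = 0] and [t = 1]. *)
Lemma gens3_not_prime :
    m != n ->
  ~ (forall s t, in_ideal [:: pi (z - x); pi (z - y)] (s * t) ->
       in_ideal [:: pi (z - x); pi (z - y)] s \/ in_ideal [:: pi (z - x); pi (z - y)] t).
Proof.
move=> ne.
have vanish (c : R[i]) p : c ^+ m = c ^+ n ->
    in_ideal [:: pi (z - x); pi (z - y)] (pi p) -> p.@[fun=> c] = 0.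
  move=> ce; apply: (presents_kernel piP (us := [:: z - x; z - y])) => //=.
    exact: gens3_vanish.
  by rewrite !mevalB !mevalXU subrr eqxx.
have yx k : in_ideal [:: pi (z - x); pi (z - y)] (pi y ^+ k - pi x ^+ k).
  rewrite subrXX; apply: in_idealMr; apply/in_ideal2P; exists 1, (-1).
  rewrite !rmorphB; ring.
(* With truncated subtraction [d] is the distance of [m] and [n]. The product of [x^(min m n)] and
   [x^d - 1] is, up to sign, [y^m - x^m] in [B], while the first factor is nonzero at [t = 1] and
   the second at [t = 0]. *)
pose d := ((m - n) + (n - m))%N.
move=> /(_ (pi (x ^+ minn m n)) (pi (x ^+ d - 1))) [].
- rewrite [pi (_ ^+ _ - 1)]rmorphB !rmorphXn rmorph1 mulrBr mulr1 -exprD.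
  have [lt|lt] := leqP m n.
    rewrite /d (eqP lt) add0n subnKC // -gens3_pi; exact: yx.
  rewrite /d (eqP (ltnW lt)) addn0 subnKC ?(ltnW lt) // -gens3_pi -[X in in_ideal _ X]opprB.
  exact/in_idealN/yx.
- move=> /(vanish 1 _) /eqP; rewrite rmorphXn /= mevalXU !expr1n oner_eq0.
  by move/(_ erefl).
- move=> /(vanish 0 _) /eqP; rewrite rmorphB rmorphXn /= mevalXU meval1 !expr0n.
  rewrite !eqn0Ngt hm hn -eqn0Ngt /=.
  have -> : (d == 0)%N = false by rewrite /d addn_eq0 !subn_eq0 -eqn_leq (negbTE ne).
  by rewrite sub0r oppr_eq0 oner_eq0 => /(_ erefl).
Qed.

End CuspPair.

(** Here [x = y] in [B], so [z - x] squares to zero. It is nonzero: [x, y, z |-> 0, 0, t] sends the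
    relations to [t^2] and 0, but [z - x] to [t]. *)
Lemma gens3_11_not_reduced (B : comNzRingType)
    (pi : {rmorphism {mpoly R[i][3]} -> B}) :
  presents (gens3 R 1 1) pi -> ~ (forall s : B, s * s = 0 -> s = 0).
Proof.
move=> piP red; have /piP.2 : pi (z - x) = 0.
  have yx : pi y = pi x by have := gens3_pi piP; rewrite !expr1.
  apply: red; rewrite [X in _ * X]rmorphB -yx -rmorphB -rmorphM.
  by apply/piP.2/in_ideal_mem; rewrite mem_head.
rewrite /gens3 !expr1 => /in_ideal2P[p [q e]].
pose f : {rmorphism {mpoly R[i][3]} -> {poly R[i]}} :=
  mmap (@polyC R[i]) (fun i => nth 0 [:: 0; 0; 'X] i).
have [fx fy fz] : [/\ f x = 0, f y = 0 & f z = 'X] by split; rewrite /f /= mmapX mmap1U.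
have := congr1 (fun p => (f p)`_1) e; cbv beta.
rewrite !rmorphD !rmorphM !rmorphD !rmorphN fx fy fz !subr0.
rewrite mulr0 addr0 mulrA coefMX /= coefMX /= coefX.
by move/eqP; rewrite oner_eq0.
Qed.

(** * The ring [R4] and its nonconstant unit *)

(** The unit [x] is 1 at [(1, 1, 1)], so [x - 1] is not invertible; at the point
    [(2^m, 2^(-n), 2^m)] of the component [z = x] it differs from 1, so [(x - 1)^2] is nonzero. *)
Lemma gens4_not_unit_gap (m n : nat) (B : comNzRingType)
    (pi : {rmorphism {mpoly R[i][3]} -> B}) :
    (0 < m)%N -> (0 < n)%N -> presents (gens4 R m n) pi ->
  ~ unit_gap B.
Proof.
move=> hm hn piP gap.
have vanish a p : all (fun g => g.@[a] == 0) (gens4 R m n) -> pi p = 0 -> p.@[a] = 0.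
  by move=> ha /piP.2; apply: rmorph_in_ideal.
have pi_xy : pi x * pi (x ^+ n.-1 * y ^+ m) = 1.
  apply/eqP; rewrite -rmorphM mulrA -exprS prednK // -subr_eq0 -(rmorph1 pi) -rmorphB.
  by apply/eqP/piP.2/in_ideal_mem; rewrite !inE eqxx orbT.
have [[t]|] := gap _ _ pi_xy.
  have [q ->] := piP.1 t => /eqP.
  rewrite -subr_eq0 -(rmorph1 pi) -rmorphB -rmorphM -rmorphB => /eqP.
  move=> /(vanish (fun=> 1)) e; have /eqP : ((x - 1) * q - 1).@[fun=> 1 : R[i]] = 0.
    apply: e.
    rewrite /= !(mevalB, mevalM, rmorphXn, meval1) /= !mevalXU !expr1n.
    by rewrite mulr1 !subrr mul0r eqxx.
  by rewrite mevalB mevalM mevalB mevalXU meval1 subrr mul0r sub0r oppr_eq0 oner_eq0.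
rewrite -(rmorph1 pi) -rmorphB -rmorphM.
pose a (i : 'I_3) : R[i] := nth 0 [:: 2 ^+ m; 2^-1 ^+ n; 2 ^+ m] i.
move=> /(vanish a) e; have /eqP : ((x - 1) * (x - 1)).@[a] = 0.
  apply: e.
  rewrite /= !(mevalB, mevalM, rmorphXn, meval1) /= !mevalXU /a /= subrr mul0r.
  by rewrite -!exprM [(n * m)%N]mulnC -exprMn divff ?pnatr_eq0 // expr1n subrr eqxx.
rewrite mevalM mevalB mevalXU meval1 /a /= mulf_eq0 orbb subr_eq0 -natrX pnatr_eq1.
by rewrite -(prednK hm) expnS; case: (2 ^ _)%N (expn_gt0 2 m.-1) => [|[|l]].
Qed.

End Space.

(** * Separation of the six pairs of rings *)

Theorem theorem3p11 (R : realType) (m n m' n' : nat)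
    (hm : (0 < m)%N) (hn : (0 < n)%N) (hmn : coprime m n)
    (hm' : (0 < m')%N) (hn' : (0 < n')%N) (hmn' : coprime m' n') :
  ~ ring_isomorphic (R1 R) (R2 R) /\
  ~ ring_isomorphic (R1 R) (R3 R m n) /\
  ~ ring_isomorphic (R1 R) (R4 R m' n') /\
  ~ ring_isomorphic (R2 R) (R3 R m n) /\
  ~ ring_isomorphic (R2 R) (R4 R m' n') /\
  ~ ring_isomorphic (R3 R m n) (R4 R m' n').
Proof.
have P1 := ideal_quot_presents (@proper1 R).
have P2 := ideal_quot_presents (@proper2 R).
have P3 := ideal_quot_presents (@proper3 R m n).
have P4 := ideal_quot_presents (@proper4 R m' n').
have mn1 : m = n -> m = 1%N /\ n = 1%N.
  by move=> mn; move: hmn; rewrite mn /coprime gcdnn => /eqP.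
have N3 : m = n -> ~ (forall s : R3 R m n, s * s = 0 -> s = 0).
  by move=> /mn1[m1 n1]; move: P3; rewrite m1 n1; apply: gens3_11_not_reduced.
split; [|split; [|split; [|split; [|split]]]].
- move=> /(presents_iso P1)[pi Q1].
  (* Both presentations now have target [R2], so the crossing ideals coincide there: maximal by the
     first, not by the second. *)
  have ideal_eq s := crossing_ideal_eq s (gens1_crossing Q1) (gens2_crossing P2).
  apply: (not_maximal_of_points P2 (gens2_vanish _) (gens2_vanish _)) => s.
  have [/ideal_eq|[t /ideal_eq]] := gens1_maximal Q1 s; first by left.
  by right; exists t.
- move=> /(presents_iso P1)[pi Q1].
  (* For [m = n] the rings differ by reducedness; otherwise [R3] has a crossing and the ideals can
     be compared. *)
  have [/N3|ne] := eqVneq m n.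
    by apply=> s; apply: crossing_reduced (gens1_crossing Q1).
  have C3 := gens3_crossing hn hmn P3 ne.
  have ideal_eq s := crossing_ideal_eq s (gens1_crossing Q1) C3.
  apply: (not_maximal_of_points P3); try apply: gens3_vanish.
  + by rewrite !expr0n !eqn0Ngt hm hn.
  + by rewrite !expr1n.
  move=> s; have [/ideal_eq|[t /ideal_eq]] := gens1_maximal Q1 s; first by left.
  by right; exists t.
- move=> /(presents_iso P1)[pi Q1].
  by apply: (gens4_not_unit_gap hm' hn' P4); apply: gens1_unit_gap Q1.
- move=> /(presents_iso P2)[pi Q2].
  have [/N3|ne] := eqVneq m n.
    by apply=> s; apply: crossing_reduced (gens2_crossing Q2).
  have C3 := gens3_crossing hn hmn P3 ne.
  (* Primality of the crossing ideal is carried over from the presentation of [R2]. *)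
  apply: (gens3_not_prime hm hn P3 ne) => s t.
  move=> /(crossing_ideal_eq _ C3 (gens2_crossing Q2)) /(gens2_prime Q2).
  by case=> /(crossing_ideal_eq _ C3 (gens2_crossing Q2)); [left|right].
- move=> /(presents_iso P2)[pi Q2].
  by apply: (gens4_not_unit_gap hm' hn' P4); apply: gens2_unit_gap Q2.
- move=> /(presents_iso P3)[pi Q3].
  by apply: (gens4_not_unit_gap hm' hn' P4); apply: gens3_unit_gap Q3.
Qed.
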